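(* Let $\omega\in\mathbb{B}$ be such that $\mathrm{Re}_{\mathbf{j}}(\omega)\gg0$. Then the integral $$\Gamma(\omega)=\int_0^\infty e^{-t}\,t^{\omega-1}\,dt$$ is absolutely convergent, i.e. $\int_0^\infty\|e^{-t}t^{\omega-1}\|_{\mathbf{j}}\,dt<\infty$.
   Context: $\mathbb{D}=\{x+\mathbf{j}y:x,y\in\mathbb{R}\}$, $\mathbf{j}^2=1$, $\mathbf{j}\notin\mathbb{R}$, is the algebra of hyperbolic numbers; with $\mathbf{e}_1=\frac{1+\mathbf{j}}{2}$, $\mathbf{e}_2=\frac{1-\mathbf{j}}{2}$, $z=x+\mathbf{j}y$ equals $\pi_1(z)\mathbf{e}_1+\pi_2(z)\mathbf{e}_2$, where $\pi_1(z)=x+y$, $\pi_2(z)=x-y$. For $z,w\in\mathbb{D}$, $z\ll w$ means $\pi_k(z)<\pi_k(w)$ for $k=1,2$. $\mathbb{B}=\mathbb{D}+\mathbf{i}\mathbb{D}$ is the commutative real algebra of bicomplex numbers $a+b\mathbf{i}+c\mathbf{j}+d\mathbf{k}$ ($a,b,c,d\in\mathbb{R}$), with $\mathbf{i}^2=\mathbf{k}^2=-1$, $\mathbf{j}^2=1$, $\mathbf{i}\mathbf{k}=\mathbf{k}\mathbf{i}=\mathbf{j}$. Each $\omega\in\mathbb{B}$ is uniquely $\omega=\mathrm{Re}_{\mathbf{j}}(\omega)+\mathbf{i}\,\mathrm{Im}_{\mathbf{j}}(\omega)$ with $\mathrm{Re}_{\mathbf{j}}(\omega),\mathrm{Im}_{\mathbf{j}}(\omega)\in\mathbb{D}$,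 and $\omega=\mathcal{P}_1(\omega)\mathbf{e}_1+\mathcal{P}_2(\omega)\mathbf{e}_2$ with $\mathcal{P}_k(\omega)=\pi_k(\mathrm{Re}_{\mathbf{j}}(\omega))+\mathbf{i}\,\pi_k(\mathrm{Im}_{\mathbf{j}}(\omega))\in\mathbb{C}$. The norm $\|\cdot\|_{\mathbf{j}}$ on $\mathbb{B}$ is $\|\omega\|_{\mathbf{j}}=\max\{|\mathcal{P}_1(\omega)|,|\mathcal{P}_2(\omega)|\}$ (the Riesz subnorm of $|\omega|_{\mathbf{j}}=|\mathcal{P}_1(\omega)|\mathbf{e}_1+|\mathcal{P}_2(\omega)|\mathbf{e}_2$). $e^\omega=\sum_{n\ge0}\omega^n/n!$, and for real $t>0$, $t^{\omega}=e^{\omega\ln t}$. *)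

(* Defs.v *)
From Stdlib Require Import Reals Factorial Lra ClassicalEpsilon.
From Coquelicot Require Import Coquelicot.
Open Scope R_scope.

(** Hyperbolic numbers: the pair [(x, y)] is [x + j y]. *)

Definition D : Type := (R * R)%type.

Definition Dplus (z w : D) : D := (fst z + fst w, snd z + snd w).
Definition Dopp (z : D) : D := (- fst z, - snd z).
Definition Dzero : D := (0, 0).
Definition Dmult (z w : D) : D :=
  (fst z * fst w + snd z * snd w, fst z * snd w + snd z * fst w).
Definition Done : D := (1, 0).

Definition pi1 (z : D) : R := fst z + snd z.
Definition pi2 (z : D) : R := fst z - snd z.

Definition Dll (z w : D) : Prop := pi1 z < pi1 w /\ pi2 z < pi2 w.

(** Bicomplex numbers: the pair [(z1, z2)] is [z1 + i z2] with [z1 z2 : D].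
    From [i k = j] one gets [k = - i j], so that
    [a + b i + c j + d k] is [((a, c), (b, - d))]. *)

Definition B : Type := (D * D)%type.

Definition Re_j (w : B) : D := fst w.
Definition Im_j (w : B) : D := snd w.

Definition Bplus (v w : B) : B :=
  (Dplus (Re_j v) (Re_j w), Dplus (Im_j v) (Im_j w)).
Definition Bopp (w : B) : B := (Dopp (Re_j w), Dopp (Im_j w)).
Definition Bzero : B := (Dzero, Dzero).
Definition Bmult (v w : B) : B :=
  (Dplus (Dmult (Re_j v) (Re_j w)) (Dopp (Dmult (Im_j v) (Im_j w))),
   Dplus (Dmult (Re_j v) (Im_j w)) (Dmult (Im_j v) (Re_j w))).
Definition Bone : B := (Done, Dzero).

Ltac bicomplex :=
  repeat match goal with
    | w : _ |- _ => change B in w; destruct w as [[? ?] [? ?]]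
    | z : C |- _ => destruct z as [? ?]
  end;
  cbv -[Rplus Rmult Ropp Rinv IZR];
  repeat apply injective_projections; cbn -[Rplus Rmult Ropp Rinv IZR]; field.

Definition B_AbelianMonoid_mixin : AbelianMonoid.mixin_of B.
Proof.
  exists Bplus Bzero; intros; abstract bicomplex.
Defined.

Canonical B_AbelianMonoid := AbelianMonoid.Pack B B_AbelianMonoid_mixin B.

Definition B_AbelianGroup_mixin : AbelianGroup.mixin_of B_AbelianMonoid.
Proof.
  exists Bopp; intros; abstract bicomplex.
Defined.

Canonical B_AbelianGroup :=
  AbelianGroup.Pack B
    (AbelianGroup.Class B B_AbelianMonoid_mixin B_AbelianGroup_mixin) B.

Definition B_Ring_mixin : Ring.mixin_of B_AbelianGroup.
Proof.
  exists Bmult Bone; intros; abstract bicomplex.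
Defined.

Canonical B_Ring :=
  Ring.Pack B (Ring.Class B (AbelianGroup.Class B B_AbelianMonoid_mixin
    B_AbelianGroup_mixin) B_Ring_mixin) B.

Lemma Bmult_comm (v w : B) : mult v w = mult w v.
Proof. bicomplex. Qed.

Definition RtoB (r : R) : B := ((r, 0), (0, 0)).
Definition CtoB (z : C) : B := ((fst z, 0), (snd z, 0)).

Definition Bi : B := ((0, 0), (1, 0)).
Definition Bj : B := ((0, 1), (0, 0)).
Definition Bk : B := ((0, 0), (0, - 1)).

Lemma Bi_Bi : mult Bi Bi = opp (one : B).
Proof. bicomplex. Qed.
Lemma Bk_Bk : mult Bk Bk = opp (one : B).
Proof. bicomplex. Qed.
Lemma Bj_Bj : mult Bj Bj = (one : B).
Proof. bicomplex. Qed.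
Lemma Bi_Bk : mult Bi Bk = Bj.
Proof. bicomplex. Qed.

Definition e1 : B := ((1 / 2, 1 / 2), (0, 0)).
Definition e2 : B := ((1 / 2, - (1 / 2)), (0, 0)).

Definition P1 (w : B) : C := (pi1 (Re_j w), pi1 (Im_j w)).
Definition P2 (w : B) : C := (pi2 (Re_j w), pi2 (Im_j w)).

Lemma idempotent_decomposition (w : B) :
  w = plus (mult (CtoB (P1 w)) e1) (mult (CtoB (P2 w)) e2).
Proof. bicomplex. Qed.

Definition normj (w : B) : R := Rmax (Cmod (P1 w)) (Cmod (P2 w)).

Definition is_Bseries (a : nat -> B) (l : B) : Prop :=
  is_lim_seq (fun n => normj (minus (sum_n a n) l)) 0.

Definition Bexp_term (w : B) (n : nat) : B :=
  mult (RtoB (/ INR (fact n))) (pow_n w n).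

(** The sum of the exponential series; the default value of [epsilon] is never
    used, see [Bexp_correct]. *)
Definition Bexp (w : B) : B :=
  epsilon (inhabits (zero : B)) (is_Bseries (Bexp_term w)).

Definition coords_abs (w : B) : R :=
  Rabs (fst (fst w)) + Rabs (snd (fst w)) +
  (Rabs (fst (snd w)) + Rabs (snd (snd w))).

Lemma coords_abs_mult (v w : B) :
  coords_abs (mult v w) <= coords_abs v * coords_abs w.
Proof.
  destruct v as [[a b] [c d]]; destruct w as [[a' b'] [c' d']].
  cbv -[Rplus Rmult Ropp Rabs IZR Rle].
  assert (H : forall p q r s : R, Rabs (p + q + - (r + s)) <=
    Rabs p + Rabs q + Rabs r + Rabs s) by (intros; split_Rabs; lra).
  assert (H' : forall p q r s : R, Rabs (p + q + (r + s)) <=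
    Rabs p + Rabs q + Rabs r + Rabs s) by (intros; split_Rabs; lra).
  eapply Rle_trans.
  - repeat apply Rplus_le_compat; first [apply H | apply H'].
  - rewrite !Rabs_mult; lra.
Qed.

Lemma coords_abs_Bexp_term (w : B) (n : nat) :
  coords_abs (Bexp_term w n) <= coords_abs w ^ n / INR (fact n).
Proof.
  assert (Hp : coords_abs (pow_n w n) <= coords_abs w ^ n).
  { induction n as [|n IH].
    - cbv -[Rplus Rmult Ropp Rabs IZR Rle].
      rewrite Rabs_R0, Rabs_R1; lra.
    - simpl. eapply Rle_trans; [apply coords_abs_mult|].
      apply Rmult_le_compat_l; [|exact IH].
      unfold coords_abs; split_Rabs; lra. }
  assert (Hf : 0 < / INR (fact n)) by (apply Rinv_0_lt_compat, INR_fact_lt_0).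
  unfold Bexp_term; eapply Rle_trans; [apply coords_abs_mult|].
  replace (coords_abs (RtoB (/ INR (fact n)))) with (/ INR (fact n)).
  - unfold Rdiv; rewrite Rmult_comm; apply Rmult_le_compat_r; lra.
  - unfold coords_abs, RtoB; simpl; rewrite Rabs_R0, Rabs_pos_eq; lra.
Qed.

Lemma normj_le_coords_abs (w : B) : normj w <= coords_abs w.
Proof.
  assert (HC : forall x y : R, Cmod (x, y) <= Rabs x + Rabs y).
  { intros x y.
    replace ((x, y) : C) with (Cplus (RtoC x) (Cmult Ci (RtoC y))).
    - eapply Rle_trans; [apply Cmod_triangle|].
      rewrite Cmod_mult, Cmod_Ci, !Cmod_R; lra.
    - apply injective_projections; simpl; ring. }
  destruct w as [[a b] [c d]].
  unfold normj, P1, P2, pi1, pi2, Re_j, Im_j, coords_abs; simpl.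
  apply Rmax_lub; (eapply Rle_trans; [apply HC|]); split_Rabs; lra.
Qed.

Lemma Bexp_term_summable (w : B) :
  exists l : B, is_Bseries (Bexp_term w) l.
Proof.
  assert (Hex : ex_series (fun n => coords_abs w ^ n / INR (fact n))).
  { exists (exp (coords_abs w)).
    eapply is_series_ext; [|apply (is_exp_Reals (coords_abs w))].
    intros n; rewrite pow_n_pow; reflexivity. }
  assert (Hc : forall p : B -> R,
    (forall v, Rabs (p v) <= coords_abs v) ->
    (forall u v, p (plus u v) = p u + p v) ->
    is_lim_seq (fun n => p (sum_n (Bexp_term w) n))
      (Series (fun n => p (Bexp_term w n)))).
  { intros p Hp Hadd.
    apply is_lim_seq_ext with (sum_n (fun n => p (Bexp_term w n))).
    - induction n as [|n IH]; [now rewrite !sum_O|].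
      now rewrite !sum_Sn, Hadd, IH.
    - apply Series_correct.
      eapply (ex_series_le (V := R_CompleteNormedModule)); [|exact Hex].
      intros n; eapply Rle_trans; [apply Hp|apply coords_abs_Bexp_term]. }
  set (S p := Series (fun n => p (Bexp_term w n))).
  exists ((S (fun v : B => fst (fst v)), S (fun v : B => snd (fst v))),
     (S (fun v : B => fst (snd v)), S (fun v : B => snd (snd v)))).
  assert (Habs : forall p : B -> R,
    (forall v, Rabs (p v) <= coords_abs v) ->
    (forall u v, p (plus u v) = p u + p v) ->
    is_lim_seq (fun n => Rabs (p (sum_n (Bexp_term w) n) - S p)) 0).
  { intros p Hp Hadd.
    replace (Finite 0) with (Rbar_abs (S p - S p))
      by (simpl; rewrite Rminus_diag, Rabs_R0; reflexivity).
    apply is_lim_seq_abs.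
    apply is_lim_seq_minus'; [now apply Hc|apply is_lim_seq_const]. }
  apply is_lim_seq_le_le with (u := fun _ => 0)
    (w := fun n => coords_abs (minus (sum_n (Bexp_term w) n)
    ((S (fun v : B => fst (fst v)), S (fun v : B => snd (fst v))),
     (S (fun v : B => fst (snd v)), S (fun v : B => snd (snd v)))))).
  - intros n; split; [|apply normj_le_coords_abs].
    eapply Rle_trans; [apply Cmod_ge_0|apply Rmax_l].
  - apply is_lim_seq_const.
  - unfold coords_abs.
    replace (Finite 0) with (Finite (0 + 0 + (0 + 0)))
      by (f_equal; lra).
    apply is_lim_seq_plus'; apply is_lim_seq_plus'.
    + apply (Habs (fun v : B => fst (fst v))); [|reflexivity].
      intros v; unfold coords_abs; split_Rabs; lra.
    + apply (Habs (fun v : B => snd (fst v))); [|reflexivity].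
      intros v; unfold coords_abs; split_Rabs; lra.
    + apply (Habs (fun v : B => fst (snd v))); [|reflexivity].
      intros v; unfold coords_abs; split_Rabs; lra.
    + apply (Habs (fun v : B => snd (snd v))); [|reflexivity].
      intros v; unfold coords_abs; split_Rabs; lra.
Qed.

Lemma Bexp_correct (w : B) : is_Bseries (Bexp_term w) (Bexp w).
Proof. unfold Bexp; apply epsilon_spec, Bexp_term_summable. Qed.

(** [t ^ w], meaningful for [0 < t] only. *)
Definition Bpower (t : R) (w : B) : B := Bexp (mult w (RtoB (ln t))).

Definition Gamma_integrand (w : B) (t : R) : B :=
  mult (RtoB (exp (- t))) (Bpower t (minus w one)).

(** Absolute convergence of the integral of [f] over the open half-line
    [(0, oo)], as a Riemann integral improper at both ends. *)
Definition abs_convergent_0_infty (f : R -> B) : Prop :=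
  ex_RInt_gen (fun t => normj (f t)) (at_right 0) (Rbar_locally p_infty).

(* Main.v *)
(** Each idempotent component [P] is an algebra morphism to the complex numbers,
    so [Cmod (P (e ^ v)) = exp (Re (P v))] and the norm of the integrand is the
    maximum of [e ^ (- t) * t ^ (c - 1)] for the two positive numbers
    [c = pi1 (Re_j w)] and [c = pi2 (Re_j w)]. Up to a constant, each of these is
    at most the derivative of the bounded function [t ^ c / (1 + t ^ c)], so the
    integrals over compact subintervals of the half-line are bounded. *)

Require Import Defs.
From Stdlib Require Import Reals Factorial Lra Lia.
From Coquelicot Require Import Coquelicot.
Open Scope R_scope.

(** * Power series with factorial decay *)

(** Outside the disk of convergence the terms [a n * r ^ n] cannot tend to 0, but at every [r >= 0]
    they are dominated by the exponential series at [M * r]. *)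
Lemma CV_radius_exp_bound (a : nat -> R) (M : R) :
  (forall n, Rabs (a n) <= M ^ n / INR (fact n)) -> CV_radius a = p_infty.
Proof.
  intros Ha.
  assert (Hr : forall r, 0 <= r -> Rbar_le r (CV_radius a)).
  { intros r Hr. apply Rbar_not_lt_le; intros Hlt.
    rewrite <- (Rabs_pos_eq r Hr) in Hlt.
    apply (CV_disk_outside _ _ Hlt), ex_series_lim_0.
    apply (ex_series_le (V := R_CompleteNormedModule))
      with (b := fun n => (M * r) ^ n / INR (fact n)).
    - intros n. change (Rabs (a n * r ^ n) <= (M * r) ^ n / INR (fact n)).
      rewrite Rabs_mult, (Rabs_pos_eq (r ^ n)), Rpow_mult_distr by now apply pow_le.
      unfold Rdiv; rewrite Rmult_assoc, (Rmult_comm (r ^ n)), <- Rmult_assoc.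
      apply Rmult_le_compat_r; [now apply pow_le|apply Ha].
    - exists (exp (M * r)).
      eapply is_series_ext; [|apply (is_exp_Reals (M * r))].
      intros n; rewrite pow_n_pow; reflexivity. }
  destruct (CV_radius a) as [r| |] eqn:E.
  - specialize (Hr (Rmax 0 r + 1)). simpl in Hr.
    pose proof (Rmax_l 0 r); pose proof (Rmax_r 0 r).
    assert (Rmax 0 r + 1 <= r) by (apply Hr; lra). lra.
  - reflexivity.
  - destruct (Hr 0); lra.
Qed.

(** The power series [F], [G] satisfy [F' = x F - y G] and [G' = y F + x G], so
    [F ^ 2 + G ^ 2] solves [u' = 2 x u]. *)
Lemma PSeries_rotation_modulus (a b : nat -> R) (x y : R) :
  CV_radius a = p_infty -> CV_radius b = p_infty ->
  a 0%nat = 1 -> b 0%nat = 0 ->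
  (forall n, PS_derive a n = x * a n - y * b n) ->
  (forall n, PS_derive b n = y * a n + x * b n) ->
  PSeries a 1 ^ 2 + PSeries b 1 ^ 2 = exp x ^ 2.
Proof.
  intros Ra Rb a0 b0 Ha Hb.
  assert (Ea : forall s, ex_pseries a s)
    by (intros s; apply CV_radius_inside; rewrite Ra; exact I).
  assert (Eb : forall s, ex_pseries b s)
    by (intros s; apply CV_radius_inside; rewrite Rb; exact I).
  assert (Hscal : forall (c : nat -> R) k s, ex_pseries c s ->
    ex_pseries (PS_scal k c) s)
    by (intros c k s Hc; apply ex_pseries_scal; [apply Rmult_comm|exact Hc]).
  assert (Da : forall s, is_derive (PSeries a) s (x * PSeries a s - y * PSeries b s)).
  { intros s. evar_last; [apply is_derive_PSeries; rewrite Ra; exact I|].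
    rewrite (PSeries_ext _ (PS_minus (PS_scal x a) (PS_scal y b))) by exact Ha.
    rewrite PSeries_minus by now apply Hscal.
    now rewrite !PSeries_scal. }
  assert (Db : forall s, is_derive (PSeries b) s (y * PSeries a s + x * PSeries b s)).
  { intros s. evar_last; [apply is_derive_PSeries; rewrite Rb; exact I|].
    rewrite (PSeries_ext _ (PS_plus (PS_scal y a) (PS_scal x b))) by exact Hb.
    rewrite PSeries_plus by now apply Hscal.
    now rewrite !PSeries_scal. }
  (* The integrating factor makes [u] constant; [u 0 = 1] because the constant coefficients are 1
     and 0. *)
  pose (u s := exp (- (2 * x * s)) * (PSeries a s ^ 2 + PSeries b s ^ 2)).
  assert (Hu : u 0 = u 1).
  { apply (eq_is_derive (V := R_NormedModule)); [|lra].
    intros s _. unfold u.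
    auto_derive.
    - repeat split; eexists; [apply Da|apply Db].
    - replace (Derive (fun r : R => PSeries a r) s) with (x * PSeries a s - y * PSeries b s)
        by (symmetry; exact (is_derive_unique _ _ _ (Da s))).
      replace (Derive (fun r : R => PSeries b r) s) with (y * PSeries a s + x * PSeries b s)
        by (symmetry; exact (is_derive_unique _ _ _ (Db s))).
      unfold zero; simpl; ring. }
  unfold u in Hu.
  rewrite !PSeries_0, a0, b0, Rmult_0_r, Ropp_0, exp_0, Rmult_1_r in Hu.
  replace (exp x ^ 2) with (exp (2 * x))
    by (simpl; rewrite Rmult_1_r, <- exp_plus; f_equal; ring).
  transitivity (exp (2 * x) * (exp (- (2 * x)) * (PSeries a 1 ^ 2 + PSeries b 1 ^ 2))).
  - rewrite <- Rmult_assoc, <- exp_plus, Rplus_opp_r, exp_0; ring.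
  - rewrite <- Hu; ring.
Qed.

(** * Idempotent components of the exponential *)

(** A common interface for [P1] and [P2]: a real algebra morphism to the complex numbers,
    contracting for [normj], hence compatible with convergent series. *)
Definition is_component (P : B -> C) : Prop :=
  (forall u v : B, P (plus u v) = Cplus (P u) (P v)) /\
  (forall u v : B, P (mult u v) = Cmult (P u) (P v)) /\
  (forall r : R, P (RtoB r) = RtoC r) /\
  (forall v : B, Cmod (P v) <= normj v).

Lemma is_component_P1 : is_component P1.
Proof.
  repeat split; intros; try bicomplex; apply Rmax_l.
Qed.

Lemma is_component_P2 : is_component P2.
Proof.
  repeat split; intros; try bicomplex; apply Rmax_r.
Qed.

(** By additivity the partial sums of the coordinates differ from [p l] by [p] of the remainder,
    which is at most the [normj] of the remainder. *)
Lemma is_Bseries_coordinate (p : B -> R) (f : nat -> B) (l : B) :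
  (forall u v : B, p (plus u v) = p u + p v) ->
  (forall v, Rabs (p v) <= normj v) ->
  is_Bseries f l -> Series (fun n => p (f n)) = p l.
Proof.
  intros Hadd Hp Hl.
  assert (Hminus : forall u v : B, p (minus u v) = p u - p v).
  { intros u v.
    enough (p u = p (minus u v) + p v) by lra.
    rewrite <- Hadd. f_equal. clear. bicomplex. }
  apply is_series_unique.
  change (is_lim_seq (sum_n (fun n => p (f n))) (p l)).
  apply is_lim_seq_ext with (fun n => p (minus (sum_n f n) l) + p l).
  - intros n. rewrite Hminus.
    replace (sum_n (fun n => p (f n)) n) with (p (sum_n f n)); [ring|].
    induction n as [|n IH]; [now rewrite !sum_O|].
    now rewrite !sum_Sn, Hadd, IH.
  - replace (Finite (p l)) with (Finite (0 + p l)) by (f_equal; ring).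
    apply is_lim_seq_plus'; [|apply is_lim_seq_const].
    apply is_lim_seq_abs_0.
    apply (is_lim_seq_le_le (fun _ => 0) _ (fun n => normj (minus (sum_n f n) l))).
    + intros n; split; [apply Rabs_pos|apply Hp].
    + apply is_lim_seq_const.
    + exact Hl.
Qed.

Lemma Rabs_Im_le_Cmod (z : C) : Rabs (Im z) <= Cmod z.
Proof. eapply Rle_trans; [apply Rmax_r|apply Rmax_Cmod]. Qed.

(** With [P v = x + i y], the curve [s -> P (e ^ (s v))] has real and imaginary parts solving the
    system of [PSeries_rotation_modulus]; the claim is its conclusion at [s = 1]. *)
Lemma Cmod_component_Bexp (P : B -> C) (v : B) :
  is_component P -> Cmod (P (Bexp v)) = exp (Re (P v)).
Proof.
  intros [Hplus [Hmult [Hreal Hle]]].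
  (* Taylor coefficients in [s] of the real and imaginary parts of [P (e ^ (s v))]. *)
  set (a := fun n => Re (P (Bexp_term v n))).
  set (b := fun n => Im (P (Bexp_term v n))).
  assert (Ha : PSeries a 1 = Re (P (Bexp v))).
  { rewrite PSeries_1.
    apply (is_Bseries_coordinate (fun u => Re (P u))).
    - intros u w; now rewrite Hplus.
    - intros u; eapply Rle_trans; [apply re_le_Cmod|apply Hle].
    - apply Bexp_correct. }
  assert (Hb : PSeries b 1 = Im (P (Bexp v))).
  { rewrite PSeries_1.
    apply (is_Bseries_coordinate (fun u => Im (P u))).
    - intros u w; now rewrite Hplus.
    - intros u; eapply Rle_trans; [apply Rabs_Im_le_Cmod|apply Hle].
    - apply Bexp_correct. }
  assert (Hbound : forall n, Cmod (P (Bexp_term v n)) <= coords_abs v ^ n / INR (fact n)).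
  { intros n; eapply Rle_trans; [apply Hle|].
    eapply Rle_trans; [apply normj_le_coords_abs|apply coords_abs_Bexp_term]. }
  (* Coefficientwise form of the equation [f' = P v * f]; its real and imaginary parts are the two
     recurrences required below. *)
  assert (Hrec : forall n, Cmult (INR (S n)) (P (Bexp_term v (S n))) =
    Cmult (P v) (P (Bexp_term v n))).
  { intros n. unfold Bexp_term. simpl pow_n.
    rewrite !Hmult, !Hreal.
    rewrite !Cmult_assoc, <- RtoC_mult.
    rewrite (Cmult_comm (P v)).
    do 2 f_equal.
    rewrite fact_simpl, mult_INR. f_equal. field.
    split; [apply INR_fact_neq_0|apply not_0_INR; lia]. }
  assert (H0 : P (Bexp_term v 0) = RtoC 1).
  { unfold Bexp_term; simpl pow_n. change (one : B) with (RtoB 1).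
    rewrite Hmult, !Hreal, <- RtoC_mult. f_equal. simpl; field. }
  unfold Cmod.
  change (fst (P (Bexp v))) with (Re (P (Bexp v))).
  change (snd (P (Bexp v))) with (Im (P (Bexp v))).
  rewrite <- Ha, <- Hb.
  rewrite (PSeries_rotation_modulus a b (Re (P v)) (Im (P v))).
  - apply sqrt_pow2; left; apply exp_pos.
  - apply (CV_radius_exp_bound _ (coords_abs v)).
    intros n; eapply Rle_trans; [apply re_le_Cmod|apply Hbound].
  - apply (CV_radius_exp_bound _ (coords_abs v)).
    intros n; eapply Rle_trans; [apply Rabs_Im_le_Cmod|apply Hbound].
  - unfold a; now rewrite H0.
  - unfold b; now rewrite H0.
  - intros n. specialize (Hrec n). apply (f_equal Re) in Hrec.
    unfold PS_derive, a, b; revert Hrec; unfold Re, Im, Cmult, RtoC; cbn [fst snd]; lra.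
  - intros n. specialize (Hrec n). apply (f_equal Im) in Hrec.
    unfold PS_derive, a, b; revert Hrec; unfold Re, Im, Cmult, RtoC; cbn [fst snd]; lra.
Qed.

Lemma Cmod_component_Gamma_integrand (P : B -> C) (w : B) (t : R) :
  is_component P ->
  Cmod (P (Gamma_integrand w t)) = exp (- t) * exp ((Re (P w) - 1) * ln t).
Proof.
  intros HP. unfold Gamma_integrand, Bpower.
  pose proof HP as [Hplus [Hmult [Hreal _]]].
  rewrite Hmult, Cmod_mult, Hreal, Cmod_R, Cmod_component_Bexp by exact HP.
  rewrite Rabs_pos_eq by (left; apply exp_pos).
  do 2 f_equal.
  replace (minus w one) with (plus w (RtoB (-1))) by bicomplex.
  rewrite Hmult, Hplus, !Hreal.
  unfold Re, Cmult, Cplus, RtoC; simpl; ring.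
Qed.

(** * Improper integrals of nonnegative functions *)

(** Integrals over compact subintervals grow with the interval, so they converge to their supremum
    [L]. *)
Lemma ex_RInt_gen_nonneg_bounded (h : R -> R) (M : R) :
  (forall t, 0 < t -> continuous h t) ->
  (forall t, 0 < t -> 0 <= h t) ->
  (forall x y, 0 < x -> x < y -> RInt h x y <= M) ->
  ex_RInt_gen h (at_right 0) (Rbar_locally p_infty).
Proof.
  intros Hc Hpos HM.
  assert (Hex : forall x y, 0 < x -> 0 < y -> ex_RInt h x y).
  { intros x y Hx Hy. apply (ex_RInt_continuous (V := R_CompleteNormedModule)).
    intros z [Hz _]; apply Hc.
    eapply Rlt_le_trans; [|exact Hz]. now apply Rmin_glb_lt. }
  destruct (completeness (fun r => exists x y, 0 < x < y /\ r = RInt h x y))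
    as [L [Hub Hlub]].
  - exists M; intros r [x [y [[Hx Hxy] ->]]]; now apply HM.
  - exists (RInt h 1 2), 1, 2; split; [lra|reflexivity].
  - exists L. intros Q [eps HQ].
    (* If no compact integral exceeded [L - eps], that number would be an upper bound below the
       least one. *)
    destruct (Classical_Prop.classic
      (exists x y, 0 < x < y /\ L - eps < RInt h x y)) as [[x0 [y0 [H0 HL]]]|Hno].
    (* Any interval containing [[x0, y0]] has its integral between that over [[x0, y0]] and [L],
       hence within [eps] of [L]. *)
    + apply Filter_prod with (fun x => 0 < x < x0) (fun y => y0 < y).
      * exists (mkposreal x0 (proj1 H0)); intros x Hx Hx0.
        unfold ball in Hx; simpl in Hx; unfold AbsRing_ball, abs, minus, plus, opp in Hx; simpl in Hx.
        revert Hx; split_Rabs; lra.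
      * exists y0; intros y Hy; exact Hy.
      * intros x y [Hx Hx0] Hy. exists (RInt h x y); split.
        -- apply (RInt_correct (V := R_CompleteNormedModule)), Hex; lra.
        -- apply HQ.
           assert (Hle : RInt h x y <= L)
             by (apply Hub; exists x, y; split; [lra|reflexivity]).
           assert (Hge : RInt h x0 y0 <= RInt h x y).
           { rewrite <- (RInt_Chasles (V := R_CompleteNormedModule) h x x0 y)
               by (apply Hex; lra).
             rewrite <- (RInt_Chasles (V := R_CompleteNormedModule) h x0 y0 y)
               by (apply Hex; lra).
             assert (0 <= RInt h x x0)
               by (apply RInt_ge_0; [lra|apply Hex; lra|intros; apply Hpos; lra]).
             assert (0 <= RInt h y0 y)
               by (apply RInt_ge_0; [lra|apply Hex; lra|intros; apply Hpos; lra]).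
             unfold plus; simpl; lra. }
           unfold ball; simpl; unfold AbsRing_ball, abs, minus, plus, opp; simpl.
           apply Rabs_def1; lra.
    + exfalso. pose proof (cond_pos eps).
      enough (L <= L - eps) by lra.
      apply Hlub; intros r [x [y [Hxy ->]]].
      apply Rnot_lt_le; intros Hlt; apply Hno; now exists x, y.
Qed.

(** * Bounds for the real gamma kernel *)

(** The inequality [1 + s <= e ^ s] at [s = ln (t / c)] gives [c ln t <= c ln c + t - c], whence the
    constant [K = c ^ c]. *)
Lemma Rpower_exp_bound (c : R) : 0 < c ->
  exists K, 0 < K /\ forall t, 0 < t -> exp (c * ln t) <= K * exp t.
Proof.
  intros Hc. exists (exp (c * ln c)); split; [apply exp_pos|].
  intros t Ht. rewrite <- exp_plus.
  assert (Hle : c * ln t <= c * ln c + t).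
  { pose proof (exp_ineq1_le (ln (t / c))) as H.
    rewrite exp_ln in H by now apply Rdiv_lt_0_compat.
    rewrite ln_div in H by assumption.
    apply (Rmult_le_compat_l c) in H; [|lra].
    replace (c * (t / c)) with t in H by (field; lra). lra. }
  destruct Hle as [Hlt| ->]; [left; now apply exp_increasing|right; reflexivity].
Qed.

(** The right-hand side is the derivative of [K * (t ^ c / (1 + t ^ c))]. *)
Lemma gamma_kernel_le_derivative (c : R) : 0 < c ->
  exists K, 0 < K /\ forall t, 0 < t ->
    exp (- t) * exp ((c - 1) * ln t) <=
    K * (c * exp (c * ln t) / (t * (1 + exp (c * ln t)) ^ 2)).
Proof.
  intros Hc.
  (* The exponent is doubled to control the square of [u = t ^ c] in the denominator: [(1 + u) ^ 2
     <= 2 (1 + u ^ 2) <= 2 (1 + K) e ^ t]. The factor [c] of the derivative accounts for the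
     division by [c] in the constant. *)
  destruct (Rpower_exp_bound (2 * c)) as [K [HK Hle]]; [lra|].
  exists (2 * (1 + K) / c). split; [apply Rdiv_lt_0_compat; lra|].
  intros t Ht. specialize (Hle t Ht).
  set (u := exp (c * ln t)) in *.
  assert (Hu : 0 < u) by apply exp_pos.
  replace (exp ((c - 1) * ln t)) with (u / t).
  2:{ replace ((c - 1) * ln t) with (c * ln t + - ln t) by ring.
      now rewrite exp_plus, exp_Ropp, exp_ln. }
  replace (exp (2 * c * ln t)) with (u * u) in Hle
    by (unfold u; rewrite <- exp_plus; f_equal; ring).
  assert (He : 1 <= exp t) by (pose proof (exp_ineq1_le t); lra).
  assert (Hsq : (1 + u) ^ 2 <= 2 * (1 + K) * exp t)
    by (pose proof (Rle_0_sqr (1 - u)) as H; unfold Rsqr in H; simpl; nra).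
  assert (Hs : 0 < (1 + u) ^ 2) by (apply pow_lt; lra).
  replace (2 * (1 + K) / c * (c * u / (t * (1 + u) ^ 2)))
    with (2 * (1 + K) / (1 + u) ^ 2 * (u / t)) by (field; split; lra).
  apply Rmult_le_compat_r; [left; now apply Rdiv_lt_0_compat|].
  rewrite exp_Ropp.
  apply (Rmult_le_reg_r (exp t * (1 + u) ^ 2)); [nra|].
  replace (/ exp t * (exp t * (1 + u) ^ 2)) with ((1 + u) ^ 2) by (field; lra).
  replace (2 * (1 + K) / (1 + u) ^ 2 * (exp t * (1 + u) ^ 2))
    with (2 * (1 + K) * exp t) by (field; lra).
  exact Hsq.
Qed.

Lemma continuous_gamma_kernel (c t : R) : 0 < t ->
  continuous (fun t => exp (- t) * exp ((c - 1) * ln t)) t.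
Proof.
  intros Ht. apply (ex_derive_continuous (V := R_NormedModule)).
  auto_derive; lra.
Qed.

Lemma gamma_kernel_RInt_bounded (c : R) : 0 < c ->
  exists M, forall x y, 0 < x -> x < y ->
    RInt (fun t => exp (- t) * exp ((c - 1) * ln t)) x y <= M.
Proof.
  intros Hc.
  destruct (gamma_kernel_le_derivative c Hc) as [K [HK Hle]].
  exists K. intros x y Hx Hxy.
  set (g := fun t => K * (c * exp (c * ln t) / (t * (1 + exp (c * ln t)) ^ 2))).
  (* This is [K * (t ^ c / (1 + t ^ c))], an antiderivative of [g] on the positive half-line. It
     takes values in [[0, K]], so its increments are at most [K]. *)
  set (H := fun t => K * (1 - / (1 + exp (c * ln t)))).
  assert (Hden : forall t, 1 < 1 + exp (c * ln t))
    by (intros t; pose proof (exp_pos (c * ln t)); lra).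
  assert (Hbd : forall t, 0 <= H t <= K).
  { intros t. specialize (Hden t). unfold H.
    assert (Hi : 0 < / (1 + exp (c * ln t))) by (apply Rinv_0_lt_compat; lra).
    assert (Hi1 : / (1 + exp (c * ln t)) <= 1)
      by (rewrite <- Rinv_1; apply Rinv_le_contravar; lra).
    split; nra. }
  assert (Hg : is_RInt g x y (minus (H y) (H x))).
  { apply (is_RInt_derive (V := R_CompleteNormedModule));
      intros t [Ht _]; rewrite Rmin_left in Ht by lra; specialize (Hden t).
    - unfold H, g. auto_derive; [repeat split; lra|field; split; lra].
    - apply (ex_derive_continuous (V := R_NormedModule)); unfold g.
      auto_derive; repeat split; try lra.
      apply Rgt_not_eq, Rmult_lt_0_compat; [lra|]. nra. }
  apply Rle_trans with (RInt g x y).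
  - apply RInt_le; [lra| | |].
    + apply (ex_RInt_continuous (V := R_CompleteNormedModule)).
      intros t [Ht _]; rewrite Rmin_left in Ht by lra.
      apply continuous_gamma_kernel; lra.
    + eexists; exact Hg.
    + intros t Ht. apply Hle; lra.
  - rewrite (is_RInt_unique _ _ _ _ Hg).
    pose proof (Hbd x); pose proof (Hbd y).
    unfold minus, plus, opp; simpl; lra.
Qed.

(** * Convergence of the bicomplex integral *)

Lemma continuous_Rmax (f g : R -> R) (t : R) :
  continuous f t -> continuous g t -> continuous (fun s => Rmax (f s) (g s)) t.
Proof.
  intros Hf Hg.
  apply continuous_ext with (fun s => / 2 * (f s + g s + Rabs (f s - g s))).
  - intros s. unfold Rmax. destruct (Rle_dec (f s) (g s)); split_Rabs; lra.
  - apply (continuous_scal_r (V := R_NormedModule)).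
    apply (continuous_plus (V := R_NormedModule)).
    + now apply (continuous_plus (V := R_NormedModule)).
    + apply continuous_Rabs_comp.
      now apply (continuous_minus (V := R_NormedModule)).
Qed.

Theorem proposition5p3 (w : B) (hw : Dll Dzero (Re_j w)) :
  abs_convergent_0_infty (Gamma_integrand w).
Proof.
  destruct hw as [h1 h2].
  replace (pi1 Dzero) with 0 in h1 by (unfold pi1; simpl; ring).
  replace (pi2 Dzero) with 0 in h2 by (unfold pi2; simpl; ring).
  (* By definition [pi1 (Re_j w)] and [pi2 (Re_j w)] are the real parts of the components of [w]. *)
  change (0 < Re (P1 w)) in h1. change (0 < Re (P2 w)) in h2.
  set (k := fun c t => exp (- t) * exp ((c - 1) * ln t)).
  assert (Hk : forall c t, 0 < k c t)
    by (intros; apply Rmult_lt_0_compat; apply exp_pos).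
  assert (Hkex : forall c x y, 0 < x -> x < y -> ex_RInt (k c) x y).
  { intros c x y Hx Hxy. apply (ex_RInt_continuous (V := R_CompleteNormedModule)).
    intros t [Ht _]; rewrite Rmin_left in Ht by lra.
    apply continuous_gamma_kernel; lra. }
  unfold abs_convergent_0_infty.
  apply ex_RInt_gen_ext_eq with (fun t => Rmax (k (Re (P1 w)) t) (k (Re (P2 w)) t)).
  { intros t. unfold normj.
    rewrite (Cmod_component_Gamma_integrand P1 w t is_component_P1).
    now rewrite (Cmod_component_Gamma_integrand P2 w t is_component_P2). }
  destruct (gamma_kernel_RInt_bounded _ h1) as [M1 HM1].
  destruct (gamma_kernel_RInt_bounded _ h2) as [M2 HM2].
  assert (Hcont : forall t, 0 < t ->
    continuous (fun t => Rmax (k (Re (P1 w)) t) (k (Re (P2 w)) t)) t)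
    by (intros t Ht; apply continuous_Rmax; now apply continuous_gamma_kernel).
  apply (ex_RInt_gen_nonneg_bounded _ (M1 + M2)).
  - exact Hcont.
  - intros t _. eapply Rle_trans; [left; apply Hk|apply Rmax_l].
  - intros x y Hx Hxy.
    (* The maximum of two positive kernels is at most their sum, so the separate bounds add up to
       [M1 + M2]. *)
    apply Rle_trans with (RInt (fun t => k (Re (P1 w)) t + k (Re (P2 w)) t) x y).
    + apply RInt_le; [lra| | |].
      * apply (ex_RInt_continuous (V := R_CompleteNormedModule)).
        intros t [Ht _]; rewrite Rmin_left in Ht by lra. apply Hcont; lra.
      * apply (ex_RInt_plus (V := R_NormedModule)); now apply Hkex.
      * intros t _. pose proof (Hk (Re (P1 w)) t); pose proof (Hk (Re (P2 w)) t).
        apply Rmax_lub; lra.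
    + rewrite (RInt_plus (V := R_CompleteNormedModule)) by now apply Hkex.
      apply Rplus_le_compat; [now apply HM1|now apply HM2].
Qed.
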